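(* Let $G$ and $H$ be two groups. There exists a topological space $X_H^G$ such that $\mathrm{Aut}(X_H^G)$ is isomorphic to $G$ and $\mathcal{E}(X_H^G)$ is isomorphic to $H$.
   Context: For a topological space $X$, $\mathrm{Aut}(X)$ denotes the group of homeomorphisms $X\to X$ under composition, and $\mathcal{E}(X)$ denotes the group of (free) homotopy classes of self-homotopy equivalences $X\to X$ under composition. *)

(* Defs.v *)
From HB Require Import structures.
From mathcomp Require Import all_boot all_order all_algebra generic_quotient.
From mathcomp Require Import all_classical all_reals all_analysis.

Set Implicit Arguments.
Unset Strict Implicit.
Unset Printing Implicit Defensive.

Import Order.TTheory GRing.Theory Num.Theory.
Import numFieldNormedType.Exports.
Local Open Scope classical_set_scope.
Local Open Scope ring_scope.
Local Open Scope quotient_scope.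

(* A map preserving products and bijective; between groups it then preserves
   units and inverses. *)
Definition group_isomorphic (G H : groupType) : Prop :=
  exists phi : {multiplicative G -> H}, bijective phi.

Section WithinComp.
Context {X Y Z : topologicalType}.

Lemma within_comp (A : set X) (B : set Y) (f : Y -> Z) (phi : X -> Y) :
  continuous phi -> (forall x, A x -> B (phi x)) ->
  {within B, continuous f} -> {within A, continuous (f \o phi)}.
Proof.
move=> cphi AB /subspace_continuousP cf; apply/subspace_continuousP => x Ax.
move=> W /(cf _ (AB _ Ax)) /= Wf.
have := cphi x _ Wf; rewrite /= /within /= !nbhs_simpl /=.
by apply: filterS => y /= + Ay; apply; exact: AB.
Qed.

End WithinComp.

Section Homotopy.
Context (R : realType).

(* A homotopy X * [0, 1] -> Y is a function on X * R that is continuous for the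
   subspace topology of X * [0, 1]; its values elsewhere are irrelevant. *)
Definition homotopic (X Y : topologicalType) (f g : X -> Y) : Prop :=
  exists h : X * R -> Y,
    [/\ {within [set: X] `*` `[0, 1], continuous h},
        forall x, h (x, 0) = f x & forall x, h (x, 1) = g x].

Definition homotopy_equivalence (X Y : topologicalType) (f : X -> Y) : Prop :=
  continuous f /\ exists g : Y -> X,
    [/\ continuous g, homotopic (g \o f) idfun & homotopic (f \o g) idfun].

Lemma homotopic_refl (X Y : topologicalType) (f : X -> Y) :
  continuous f -> homotopic f f.
Proof.
move=> cf; exists (f \o fst); split => //; apply: continuous_subspaceT.
by move=> x; apply: continuous_comp; [exact: cvg_fst | exact: cf].
Qed.

Lemma continuous_cylinder_affine (X : topologicalType) (a b : R) :
  continuous (fun p : X * R => (p.1, a * p.2 + b)).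
Proof.
move=> p; apply: (@cvg_pair _ _ _ _ (nbhs p.1) (nbhs (a * p.2 + b))).
  exact: cvg_fst.
apply: cvgD; last exact: cvg_cst.
by apply: cvgM; [exact: cvg_cst | exact: cvg_snd].
Qed.

Lemma homotopic_sym (X Y : topologicalType) (f g : X -> Y) :
  homotopic f g -> homotopic g f.
Proof.
move=> [h [ch h0 h1]].
exists (h \o (fun p : X * R => (p.1, -1 * p.2 + 1))); split.
- apply: within_comp ch; first exact: continuous_cylinder_affine.
  move=> [x t] [_ /=]; rewrite /= !in_itv /= => /andP[t0 t1].
  by split => //; rewrite /= mulN1r addrC subr_ge0 t1 gerBl.
- by move=> x /=; rewrite mulr0 add0r h1.
- by move=> x /=; rewrite mulr1 addNr h0.
Qed.

Lemma homotopic_trans (X Y : topologicalType) (f g k : X -> Y) :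
  homotopic f g -> homotopic g k -> homotopic f k.
Proof.
move=> [h [ch h0 h1]] [l [cl l0 l1]].
pose u := h \o (fun p : X * R => (p.1, 2 * p.2 + 0)).
pose v := l \o (fun p : X * R => (p.1, 2 * p.2 + (- 1))).
pose w (p : X * R) := if p.2 <= 2^-1 then u p else v p.
pose A : set (X * R) := snd @^-1` `[0, 2^-1].
pose B : set (X * R) := snd @^-1` `[2^-1, 1].
have cA : closed A.
  by apply: closed_comp => [p _|]; [exact: cvg_snd | exact: interval_closed].
have cB : closed B.
  by apply: closed_comp => [p _|]; [exact: cvg_snd | exact: interval_closed].
exists w; split.
- have -> : [set: X] `*` `[0, 1] = A `|` B.
    rewrite eqEsubset; split=> -[x t]; rewrite /A /B /= !in_itv /=.
      move=> [_ /andP[t0 t1]].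
      by case: (leP t 2^-1) => ht; [left; rewrite t0 | right; rewrite (ltW ht)].
    have h2 : 0 <= 2^-1 :> R by rewrite invr_ge0.
    have h3 : 2^-1 <= 1 :> R by rewrite invf_le1 ?ler1n.
    case=> /andP[t0 t1]; split => //.
      by rewrite t0 (le_trans t1).
    by rewrite t1 (le_trans h2).
  apply: withinU_continuous => //.
  + apply: (@subspace_eq_continuous _ _ _ u).
      by move=> [x t]; rewrite inE /A /w /from_subspace /= in_itv /= => /andP[_ ->].
    apply: within_comp ch; first exact: continuous_cylinder_affine.
    move=> [x t]; rewrite /A /= !in_itv /= addr0 => /andP[t0 t1].
    by split => //; rewrite mulr_ge0 //= -ler_pdivlMl // mulr1.
  + apply: (@subspace_eq_continuous _ _ _ v).
      move=> [x t]; rewrite inE /B /w /from_subspace /= in_itv /= => /andP[t0 _].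
      case: ifP => // t1; have -> : t = 2^-1 by apply/le_anti; rewrite t1.
      by rewrite /u /v /= divff ?pnatr_eq0 // addr0 subrr h1 l0.
    apply: within_comp cl; first exact: continuous_cylinder_affine.
    move=> [x t]; rewrite /B /= !in_itv /= => /andP[t0 t1].
    split => //; rewrite subr_ge0 -ler_pdivrMl // mulr1 t0 /= lerBlDr.
    by rewrite -[leRHS]mulr1 ler_pM2l.
- by move=> x; rewrite /w /= invr_ge0 ler0n /u /= mulr0 addr0 h0.
- move=> x; rewrite /w /= leNgt invf_lt1 ?ltr1n //= /v /= mulr1.
  by rewrite -[2]/(1 + 1) addrK l1.
Qed.

Lemma homotopic_comp (X Y Z : topologicalType) (f f' : X -> Y) (g g' : Y -> Z) :
  continuous f' -> continuous g -> homotopic f f' -> homotopic g g' ->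
  homotopic (g \o f) (g' \o f').
Proof.
move=> cf' cg [h [ch h0 h1]] [l [cl l0 l1]].
apply: (@homotopic_trans _ _ _ (g \o f')).
  exists (g \o h); split => [||x /=]; [|by move=> x /=; rewrite h0|by rewrite h1].
  apply/subspace_continuousP => p Ap.
  have /subspace_continuousP/(_ p Ap) chp := ch.
  exact: (cvg_comp _ _ chp (cg _)).
exists (l \o (fun p : X * R => (f' p.1, p.2))).
split => [||x /=]; [|by move=> x /=; rewrite l0|by rewrite l1].
apply: within_comp cl; last by move=> [x t] [].
move=> p; apply: (@cvg_pair _ _ _ _ (nbhs (f' p.1)) (nbhs p.2)).
  by apply: (cvg_comp _ _ cvg_fst); exact: cf'.
exact: cvg_snd.
Qed.

End Homotopy.

Definition homeomorphism (X Y : topologicalType) (f : X -> Y) : Prop :=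
  continuous f /\ exists g : Y -> X,
    [/\ continuous g, cancel f g & cancel g f].

Section AutTop.
Context (X : topologicalType).

Definition AutTop : Type := {f : continuousType X X | `[< homeomorphism f >]}.

HB.instance Definition _ := Choice.on AutTop.

Implicit Types f g : AutTop.

Definition mkAutTop (f : X -> X) (hf : homeomorphism f) : AutTop :=
  exist (fun f : continuousType X X => is_true `[< homeomorphism f >])
    (mkcts hf.1) (asboolT hf).

Lemma autP f : homeomorphism (val f).
Proof. exact/asboolP/(valP f). Qed.

Lemma aut_eqP f g : val f =1 val g -> f = g.
Proof. by move=> fg; apply/val_inj/continuousEP. Qed.

Lemma homeomorphism_id : homeomorphism (@idfun X).
Proof. by split; [exact: cts_fun | exists idfun; split => //; exact: cts_fun]. Qed.

Lemma homeomorphism_comp f g : homeomorphism (val f \o val g).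
Proof.
split; first exact: cts_fun.
have [cf [f' [cf' ff' f'f]]] := autP f; have [cg [g' [cg' gg' g'g]]] := autP g.
exists (g' \o f'); split => [x|x /=|x /=].
- by apply: continuous_comp; [exact: cf' | exact: cg'].
- by rewrite ff' gg'.
- by rewrite g'g f'f.
Qed.

Lemma aut_inv_subproof f : exists g : AutTop,
  cancel (val f) (val g) /\ cancel (val g) (val f).
Proof.
have [cf [g [cg fg gf]]] := autP f.
have hg : homeomorphism g by split => //; exists (val f).
by exists (mkAutTop hg).
Qed.

Definition aut_one : AutTop := mkAutTop homeomorphism_id.
Definition aut_mul f g : AutTop := mkAutTop (homeomorphism_comp f g).
Definition aut_inv f : AutTop := projT1 (cid (aut_inv_subproof f)).

Lemma aut_mulA : associative aut_mul.
Proof. by move=> f g h; apply: aut_eqP. Qed.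

Lemma aut_mul1 : left_id aut_one aut_mul.
Proof. by move=> f; apply: aut_eqP. Qed.

Lemma aut_mulr1 : right_id aut_one aut_mul.
Proof. by move=> f; apply: aut_eqP. Qed.

Lemma aut_mulV : left_inverse aut_one aut_inv aut_mul.
Proof.
move=> f; apply: aut_eqP => x /=; rewrite /aut_inv.
by case: cid => g [/= fg _]; exact: fg.
Qed.

Lemma aut_mulrV : right_inverse aut_one aut_inv aut_mul.
Proof.
move=> f; apply: aut_eqP => x /=; rewrite /aut_inv.
by case: cid => g [/= _ gf]; exact: gf.
Qed.

HB.instance Definition _ :=
  isGroup.Build AutTop aut_mulA aut_mul1 aut_mulr1 aut_mulV aut_mulrV.

End AutTop.

Section SelfEquivalences.
Context (R : realType) (X : topologicalType).

Definition self_equiv : Type :=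
  {f : continuousType X X | `[< homotopy_equivalence R f >]}.

HB.instance Definition _ := Choice.on self_equiv.

Implicit Types f g : self_equiv.

Definition mk_self_equiv (f : X -> X) (hf : homotopy_equivalence R f) :
    self_equiv :=
  exist (fun f : continuousType X X => is_true `[< homotopy_equivalence R f >])
    (mkcts hf.1) (asboolT hf).

Definition homotopic_rel : rel self_equiv :=
  fun f g => `[< homotopic R (val f) (val g) >].

Lemma homotopic_rel_refl : reflexive homotopic_rel.
Proof. by move=> f; apply/asboolP/homotopic_refl/cts_fun. Qed.

Lemma homotopic_rel_sym : symmetric homotopic_rel.
Proof. by move=> f g; apply/asboolP/asboolP; exact: homotopic_sym. Qed.

Lemma homotopic_rel_trans : transitive homotopic_rel.
Proof.
by move=> g f h /asboolP fg /asboolP gh; apply/asboolP/(homotopic_trans fg gh).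
Qed.

Canonical homotopic_equiv_rel := EquivRel homotopic_rel
  homotopic_rel_refl homotopic_rel_sym homotopic_rel_trans.

(* The group E(X): free homotopy classes of self-homotopy equivalences. *)
Definition hAut : Type := {eq_quot homotopic_equiv_rel}.

HB.instance Definition _ := Choice.on hAut.
HB.instance Definition _ := Quotient.on hAut.

Lemma self_equivP f : homotopy_equivalence R (val f).
Proof. exact/asboolP/(valP f). Qed.

Lemma hAut_eqP f g :
  \pi_hAut f = \pi_hAut g <-> homotopic R (val f) (val g).
Proof. by split=> [/eqmodP/asboolP|] // fg; apply/eqmodP/asboolP. Qed.

Lemma homotopy_equivalence_id : homotopy_equivalence R (@idfun X).
Proof.
split; first exact: cts_fun.
by exists idfun; split; [|apply: homotopic_refl..]; exact: cts_fun.
Qed.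

Lemma homotopy_equivalence_comp f g :
  homotopy_equivalence R (val f \o val g).
Proof.
split; first exact: cts_fun.
have [cf [f' [cf' ff' f'f]]] := self_equivP f.
have [cg [g' [cg' gg' g'g]]] := self_equivP g.
exists (g' \o f'); split.
- by move=> x; apply: continuous_comp; [exact: cf' | exact: cg'].
- apply: homotopic_trans gg'.
  apply: (@homotopic_comp _ _ _ _ (f' \o val f \o val g) (val g) g' g') => //.
    exact: (@homotopic_comp _ _ _ _ (val g) (val g) (f' \o val f) idfun
      cg (fun x => continuous_comp (cf x) (cf' _)) (homotopic_refl R cg) ff').
  exact: homotopic_refl.
- apply: homotopic_trans f'f.
  apply: (@homotopic_comp _ _ _ _ (val g \o g' \o f') f' (val f) (val f)) => //.
    exact: (@homotopic_comp _ _ _ _ f' f' (val g \o g') idfun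
      cf' (fun x => continuous_comp (cg' x) (cg _)) (homotopic_refl R cf') g'g).
  exact: homotopic_refl.
Qed.

Lemma self_equiv_inv_subproof f : exists g : self_equiv,
  homotopic R (val g \o val f) idfun /\ homotopic R (val f \o val g) idfun.
Proof.
have [cf [g [cg fg gf]]] := self_equivP f.
have hg : homotopy_equivalence R g by split => //; exists (val f).
by exists (mk_self_equiv hg).
Qed.

Definition self_equiv_id : self_equiv := mk_self_equiv homotopy_equivalence_id.
Definition self_equiv_comp f g : self_equiv :=
  mk_self_equiv (homotopy_equivalence_comp f g).
Definition self_equiv_inv f : self_equiv :=
  projT1 (cid (self_equiv_inv_subproof f)).

Definition hAut_one : hAut := \pi_hAut self_equiv_id.
(* Composition of representatives; hAut_mulE shows that the choice made by repr
   does not matter. *)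
Definition hAut_mul (a b : hAut) : hAut :=
  \pi_hAut (self_equiv_comp (repr a) (repr b)).
Definition hAut_inv (a : hAut) : hAut := \pi_hAut (self_equiv_inv (repr a)).

Lemma hAut_mulE f g :
  hAut_mul (\pi_hAut f) (\pi_hAut g) = \pi_hAut (self_equiv_comp f g).
Proof.
apply/hAut_eqP; apply: homotopic_comp; try exact: cts_fun.
  by apply/hAut_eqP; rewrite reprK.
by apply/hAut_eqP; rewrite reprK.
Qed.

Lemma hAut_mulA : associative hAut_mul.
Proof.
elim/quotW => f; elim/quotW => g; elim/quotW => h.
rewrite (hAut_mulE g h) (hAut_mulE f g) (hAut_mulE f) hAut_mulE.
by congr (\pi_hAut _); apply/val_inj/continuousEP.
Qed.

Lemma hAut_mul1 : left_id hAut_one hAut_mul.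
Proof.
elim/quotW => f; rewrite hAut_mulE.
by congr (\pi_hAut _); apply/val_inj/continuousEP.
Qed.

Lemma hAut_mulr1 : right_id hAut_one hAut_mul.
Proof.
elim/quotW => f; rewrite hAut_mulE.
by congr (\pi_hAut _); apply/val_inj/continuousEP.
Qed.

Lemma hAut_mulV : left_inverse hAut_one hAut_inv hAut_mul.
Proof.
move=> a; rewrite -[X in hAut_mul _ X]reprK hAut_mulE; apply/hAut_eqP => /=.
by rewrite /self_equiv_inv; case: cid => g [].
Qed.

Lemma hAut_mulrV : right_inverse hAut_one hAut_inv hAut_mul.
Proof.
move=> a; rewrite -[X in hAut_mul X _]reprK hAut_mulE; apply/hAut_eqP => /=.
by rewrite /self_equiv_inv; case: cid => g [].
Qed.

HB.instance Definition _ := isGroup.Build hAut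
  hAut_mulA hAut_mul1 hAut_mulr1 hAut_mulV hAut_mulrV.

End SelfEquivalences.

(* Main.v *)
(* All spaces are posets with their Alexandroff topology (open sets are the
   down-sets), so continuous maps are the monotone ones. For a group K, a
   height-one poset [cayley K] is built whose automorphisms are exactly the left
   translations by K: the maximal elements [Edge x d] lie above x.{e | e <= d}
   for a fixed well-order on bool * K, and an automorphism of a well-order is
   trivial. Every element of [cayley K] lies on a four-element crown, and a crown
   is fixed by any homotopy starting at the identity, because the set of times at
   which it is fixed is clopen in [0, 1]; hence E(cayley K) = Aut(cayley K) = K.
   Finally [cayley G] is glued to [cayley H] below one maximal point having
   trivial stabilizer: this pins down the [cayley H] part, leaving G as the
   automorphism group, but the glued part contracts, so that the homotopy type
   is still that of [cayley H]. *)
Require Import Defs.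
From mathcomp Require Import all_boot all_order all_algebra.
From mathcomp Require Import all_classical all_reals all_analysis.
From mathcomp Require Import wochoice.
From HB Require Import structures.

Set Implicit Arguments.
Unset Strict Implicit.
Unset Printing Implicit Defensive.

Import Order.TTheory GRing.Theory Num.Theory.
Import numFieldNormedType.Exports.
Local Open Scope classical_set_scope.

(** * Preliminaries on groups and well-orders *)

Lemma group_isomorphic_inv (A G : groupType) (psi : G -> A) :
  {morph psi : x y / (x * y)%g} -> injective psi ->
  (forall a, exists x, psi x = a) -> group_isomorphic A G.
Proof.
move=> psiM psi_inj psi_surj.
pose phi a := sval (cid (psi_surj a)).
have phiK : cancel phi psi by move=> a; rewrite /phi; case: cid.
have psiK : cancel psi phi by move=> x; apply: psi_inj; rewrite phiK.
have phiM : {morph phi : x y / (x * y)%g}.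
  by move=> a b; apply: psi_inj; rewrite psiM !phiK.
pose m := isMultiplicative.Build _ _ phi phiM.
pose phi' : {multiplicative A -> G} := HB.pack phi m.
by exists phi'; exists psi.
Qed.

(** Let [d] be the least moved element. Its preimage and its image are moved too, so both lie above
    [d]; applying [f] to the first comparison puts [f d] below [d], and antisymmetry gives
    [f d = d]. *)
Lemma well_order_auto_id (T : eqType) (r : rel T) (f : T -> T) :
  well_order r -> injective f -> (forall y, exists x, f x = y) ->
  (forall x y, r x y = r (f x) (f y)) -> forall x, f x = x.
Proof.
move=> r_wo f_inj f_surj f_mono x; apply: contrapT => fx.
have r_anti x1 x2 : r x1 x2 -> r x2 x1 -> x1 = x2.
  move=> h1 h2; apply: (wo_chain_antisymmetric (withinW r_wo) (C := predT)) => //.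
  by rewrite h1.
have [|d [[]]] := r_wo [pred y | f y != y]; first by exists x; apply/eqP.
rewrite inE => /eqP fd d_min _.
have d_le y : f y <> y -> r d y by move=> /eqP fy; apply: d_min.
have [e fe] := f_surj d.
have e_d : e <> d by move=> ed; apply: fd; rewrite -{1}ed.
have fed : f e <> e by rewrite fe => /esym.
have r_fd_d : r (f d) d by rewrite -fe -f_mono fe; apply: d_le.
have : r d (f d) by apply: d_le => /f_inj.
by move=> /r_anti /(_ r_fd_d) /esym.
Qed.

(** * Alexandroff topologies *)

(** The relation is a phantom argument, so that different relations on one carrier give different
    topological spaces. *)
Definition alexandroff (T : choiceType) (r : T -> T -> Prop) : Type := T.

Section Alexandroff.
Context (T : choiceType) (r : T -> T -> Prop).

HB.instance Definition _ := Choice.on (alexandroff r).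

Let downset (U : set (alexandroff r)) := forall x y, r y x -> U x -> U y.

Let downset_setT : downset setT. Proof. by []. Qed.

Let downset_setI : setI_closed downset.
Proof. by move=> A B hA hB x y yx [Ax Bx]; split; [apply: hA Ax|apply: hB Bx]. Qed.

Let downset_bigcup (I : Type) (F : I -> set (alexandroff r)) :
  (forall i, downset (F i)) -> downset (\bigcup_i F i).
Proof. by move=> hF x y yx [i _ Fx]; exists i => //; apply: hF Fx. Qed.

HB.instance Definition _ :=
  isOpenTopological.Build (alexandroff r)
    downset_setT downset_setI downset_bigcup.

Lemma alexandroff_openE (U : set (alexandroff r)) :
  open U <-> forall x y, r y x -> U x -> U y.
Proof. by []. Qed.

Lemma alexandroff_nbhs (x y : alexandroff r) (U : set (alexandroff r)) :
  nbhs x U -> r y x -> U y.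
Proof. by rewrite nbhsE => -[V [oV Vx] VU] yx; apply/VU/(oV x). Qed.

End Alexandroff.

Lemma monotone_continuous (S T : choiceType) (r : S -> S -> Prop)
    (r' : T -> T -> Prop) (f : S -> T) :
  (forall x y, r y x -> r' (f y) (f x)) ->
  continuous (f : alexandroff r -> alexandroff r').
Proof.
move=> f_mono; apply/continuousP => U oU; apply/alexandroff_openE => x y yx Ux.
exact: (oU (f x)) (f_mono _ _ yx) Ux.
Qed.

Section AlexandroffPreorder.
Context (T : choiceType) (r : T -> T -> Prop).
Hypotheses (r_refl : forall x, r x x).
Hypotheses (r_trans : forall x y z, r x y -> r y z -> r x z).

Lemma alexandroff_nbhs_down (x : alexandroff r) :
  nbhs x [set y : alexandroff r | r y x].
Proof.
apply: open_nbhs_nbhs; split; last exact: r_refl.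
by apply/alexandroff_openE => y z zy yx; apply: r_trans yx.
Qed.

Lemma continuous_monotone (S : choiceType) (r' : S -> S -> Prop) (f : S -> T) :
  continuous (f : alexandroff r' -> alexandroff r) ->
  forall x y, r' y x -> r (f y) (f x).
Proof.
move=> cf x y yx.
exact: (alexandroff_nbhs (cf x _ (alexandroff_nbhs_down (f x))) yx).
Qed.

Context (R : realType).

(** A neighbourhood of [(x, t)] mapped below [h (x, t)] contains a product [A * B], and [A] contains
    everything below [x]. Hence one neighbourhood of [t] serves all [y] below [x] at once. *)
Lemma homotopy_le (S : choiceType) (r' : S -> S -> Prop)
    (h : alexandroff r' * R -> alexandroff r) :
  {within [set: alexandroff r'] `*` `[0%R, 1%R], continuous h} ->
  forall t : R, `[0%R, 1%R] t -> forall x, \forall s \near t,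
    `[0%R, 1%R] s -> forall y, r' y x -> r (h (y, s)) (h (x, t)).
Proof.
move=> /subspace_continuousP ch t t01 x.
have /(ch (x, t))/(_ _ (alexandroff_nbhs_down _)) :
  ([set: alexandroff r'] `*` `[0%R, 1%R]) (x, t) by [].
rewrite /= /within /= nbhs_simpl /= => -[[A B] /= [nA nB] AB].
near=> s => s01 y yx.
apply: (AB (y, s)) => //; split => /=; last by near: s.
exact: alexandroff_nbhs yx.
Unshelve. all: by end_near. Qed.

(* A four-point model of the circle, sitting in the poset so that it cannot be
   pushed off itself. *)
Record crown (a1 a2 b1 b2 : T) : Prop := Crown {
  crown_a1b1 : r a1 b1;
  crown_a1b2 : r a1 b2;
  crown_a2b1 : r a2 b1;
  crown_a2b2 : r a2 b2;
  crown_min1 : forall y, r y a1 -> y = a1;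
  crown_min2 : forall y, r y a2 -> y = a2;
  crown_max1 : forall y, r b1 y -> y = b1;
  crown_max2 : forall y, r b2 y -> y = b2;
  crown_meet1 : forall y, r a1 y -> r y b1 -> r y b2 -> y = a1;
  crown_meet2 : forall y, r a2 y -> r y b1 -> r y b2 -> y = a2;
  crown_join1 : forall y, r a1 y -> r a2 y -> r y b1 -> y = b1;
  crown_join2 : forall y, r a1 y -> r a2 y -> r y b2 -> y = b2 }.

(** The values at times near [t] lie below the value at [t]. This one-sided control suffices to make
    the set of times fixing the crown both open and closed in the connected interval. *)
Lemma crown_homotopy_fixed (a1 a2 b1 b2 : T)
    (h : alexandroff r * R -> alexandroff r) :
  crown a1 a2 b1 b2 ->
  {within [set: alexandroff r] `*` `[0%R, 1%R], continuous h} ->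
  (forall x, h (x, 0%R) = x) ->
  forall t : R, `[0%R, 1%R] t ->
  [/\ h (a1, t) = a1, h (a2, t) = a2, h (b1, t) = b1 & h (b2, t) = b2].
Proof.
move=> [a11 a12 a21 a22 min1 min2 max1 max2 meet1 meet2 join1 join2] ch h0.
have h_mono (t : R) (t01 : `[0%R, 1%R] t) x y : r y x -> r (h (y, t)) (h (x, t)).
  by have /nbhs_singleton := homotopy_le ch t01 x; apply.
pose fixed t :=
  [/\ h (a1, t) = a1, h (a2, t) = a2, h (b1, t) = b1 & h (b2, t) = b2].
pose B : set R := `[0%R, 1%R] `&` fixed.
suff BE : B = `[0%R, 1%R] by move=> t; rewrite -BE => -[].
have near_le (t : R) (t01 : `[0%R, 1%R] t) x :
    \forall s \near t, `[0%R, 1%R] s -> r (h (x, s)) (h (x, t)).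
  by apply: filterS (homotopy_le ch t01 x) => s + s01; apply.
apply: (@segment_connected R 0%R 1%R).
- by exists 0%R; split; [rewrite /= in_itv /= lexx ler01 | split].
(* The implication admits all times outside the interval, so that an open set of [R] cuts out [B]
   even at the endpoints. *)
- exists (interior [set s | `[0%R, 1%R] s -> fixed s]); first exact: open_interior.
  rewrite eqEsubset; split => [t [t01 [f1 f2 f3 f4]]|t [t01 /interior_subset]].
    split => //; rewrite /interior /=.
    near=> s => s01.
    (* Near a fixed time values can only go down: the minimal points stay, and the images of [b1]
       and [b2] remain above both of them, so the join conditions hold them in place. *)
    have e1 : h (a1, s) = a1.
      by apply: min1; rewrite -{2}f1; move: s01; near: s; exact: near_le.
    have e2 : h (a2, s) = a2.
      by apply: min2; rewrite -{2}f2; move: s01; near: s; exact: near_le.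
    split => //.
    + apply: join1; [rewrite -{1}e1|rewrite -{1}e2|rewrite -{2}f3].
      * exact: h_mono.
      * exact: h_mono.
      * by move: s01; near: s; exact: near_le.
    + apply: join2; [rewrite -{1}e1|rewrite -{1}e2|rewrite -{2}f4].
      * exact: h_mono.
      * exact: h_mono.
      * by move: s01; near: s; exact: near_le.
  by move=> /(_ t01).
- exists (closure B); first exact: closed_closure.
  rewrite eqEsubset; split => [t Bt|t [t01 clBt]].
    by split; [case: Bt | exact: subset_closure].
  (* At a limit time values can only have gone up: the maximal points stay, and the meet conditions
     then hold [a1] and [a2] in place. *)
  have near_fixed x : (forall s, fixed s -> h (x, s) = x) -> r x (h (x, t)).
    move=> fx; have [s [[s01 /fx xs] /(_ s01)]] := clBt _ (near_le t t01 x).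
    by rewrite xs.
  have e3 : h (b1, t) = b1 by apply/max1/near_fixed => s [].
  have e4 : h (b2, t) = b2 by apply/max2/near_fixed => s [].
  split => //; split => //.
  + apply: meet1; [by apply: near_fixed => s []|rewrite -e3|rewrite -e4];
      exact: h_mono.
  + apply: meet2; [by apply: near_fixed => s []|rewrite -e3|rewrite -e4];
      exact: h_mono.
Unshelve. all: by end_near. Qed.

End AlexandroffPreorder.

(** * The Cayley poset of a group and its translations *)

(* Height-one poset: [Src], [Apex], [Tgt] are minimal, [Edge] and [Lid] are
   maximal. The boolean factor makes two [Tgt]'s available even when [K] is
   trivial. *)
Inductive cayley (K : groupType) : Type :=
| Src of K
| Apex
| Tgt of bool * K
| Edge of K & option (bool * K)
| Lid.
Arguments Apex {K}.
Arguments Lid {K}.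

HB.instance Definition _ (K : groupType) := gen_eqMixin (cayley K).
HB.instance Definition _ (K : groupType) := gen_choiceMixin (cayley K).

Section Cayley.
Context {K : groupType}.
Implicit Types (a b l : cayley K) (x k : K) (d : bool * K).

Let wo : rel (bool * K)%type := sval (well_ordering_principle (bool * K)%type).

Let wo_well_order : well_order wo.
Proof. exact: (svalP (well_ordering_principle (bool * K)%type)). Qed.

Let wo_total d d' : wo d d' || wo d' d.
Proof. exact: (wo_chainW (withinW wo_well_order) (C := predT)). Qed.

Let wo_refl d : wo d d.
Proof. by have := wo_total d d; rewrite orbb. Qed.

Let wo_anti d d' : wo d d' -> wo d' d -> d = d'.
Proof.
move=> h1 h2.
apply: (wo_chain_antisymmetric (withinW wo_well_order) (C := predT)) => //.
by rewrite h1.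
Qed.

Let wo_trans d1 d2 d3 : wo d1 d2 -> wo d2 d3 -> wo d1 d3.
Proof.
move=> h12 h23.
(* If the least of the three is [d1], the claim is immediate; otherwise antisymmetry identifies it
   with its predecessor in the list. *)
have [|m [[]]] := wo_well_order (A := [pred d | d \in [:: d1; d2; d3]]).
  by exists d1; rewrite !inE eqxx.
rewrite !inE => /or3P[]/eqP-> m_min _.
- by apply: m_min; rewrite !inE eqxx !orbT.
- by rewrite (wo_anti h12 (m_min d1 _)) // !inE eqxx.
- by rewrite -(wo_anti h23 (m_min d2 _)) // !inE eqxx !orbT.
Qed.

Definition shift x d : bool * K := (d.1, (x * d.2)%g).

Lemma shift1 d : shift 1%g d = d.
Proof. by case: d => i y; rewrite /shift mul1g. Qed.

Lemma shiftM x y d : shift (x * y)%g d = shift x (shift y d).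
Proof. by rewrite /shift /= mulgA. Qed.

Lemma shiftK x : cancel (shift x) (shift x^-1%g).
Proof. by move=> d; rewrite -shiftM mulVg shift1. Qed.

Lemma shiftVK x : cancel (shift x^-1%g) (shift x).
Proof. by move=> d; rewrite -shiftM mulgV shift1. Qed.

(** The edges at source [x] carry a copy of [wo] transported by [x]: the targets below them are the
    translated initial segments, with [None] for the empty one. [Lid] covers all targets but no
    source. *)
Definition cayley_lt a b : Prop :=
  match a, b with
  | Src x, Edge y _ => x = y
  | Apex, Edge _ _ => True
  | Apex, Lid => True
  | Tgt d, Edge x (Some d') => wo (shift x^-1%g d) d'
  | Tgt _, Lid => True
  | _, _ => False
  end.

Definition cayley_le a b : Prop := a = b \/ cayley_lt a b.

Definition cayley_max a : bool :=
  match a with Edge _ _ | Lid => true | _ => false end.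

Lemma cayley_lt_max a b : cayley_lt a b -> ~~ cayley_max a /\ cayley_max b.
Proof. by case: a => [x||d|x c|]; case: b => [y||d'|y c'|]. Qed.

Lemma cayley_le_refl a : cayley_le a a. Proof. by left. Qed.

Lemma cayley_le_trans a b c : cayley_le a b -> cayley_le b c -> cayley_le a c.
Proof.
move=> [->//|ab] [<-|be]; first by right.
have [_ mb] := cayley_lt_max ab.
by have := cayley_lt_max be; rewrite mb => -[].
Qed.

Lemma cayley_le_min a b : ~~ cayley_max b -> cayley_le a b -> a = b.
Proof. by move=> mb [//|/cayley_lt_max[_]]; rewrite (negPf mb). Qed.

Lemma cayley_le_max a b : cayley_max a -> cayley_le a b -> b = a.
Proof. by move=> ma [//|/cayley_lt_max[]]; rewrite ma. Qed.

(** [Apex] lies strictly below every maximal element. The right-hand side is visibly invariant under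
    order automorphisms. *)
Lemma cayley_maxP b : cayley_max b <-> exists a, a <> b /\ cayley_le a b.
Proof.
split=> [mb|[a [ab [//|/cayley_lt_max[]]]]] //.
by exists Apex; case: b mb => // *; split => //; right.
Qed.

Lemma ex_cayley_max a : exists e, cayley_max e /\ cayley_le a e.
Proof.
case: a => [x||d|x c|].
- by exists (Edge x None); split=> //; right.
- by exists Lid; split=> //; right.
- by exists Lid; split=> //; right.
- by exists (Edge x c); split=> //; left.
- by exists Lid; split=> //; left.
Qed.

Definition translate k a : cayley K :=
  match a with
  | Src x => Src (k * x)%g
  | Apex => Apex
  | Tgt d => Tgt (shift k d)
  | Edge x c => Edge (k * x)%g c
  | Lid => Lid
  end.

Lemma translate1 a : translate 1%g a = a.
Proof. by case: a => [x||d|x c|] //=; rewrite ?mul1g ?shift1. Qed.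

Lemma translateM k k' a : translate (k * k')%g a = translate k (translate k' a).
Proof. by case: a => [x||d|x c|] //=; rewrite ?mulgA ?shiftM. Qed.

Lemma translateK k : cancel (translate k) (translate k^-1%g).
Proof. by move=> a; rewrite -translateM mulVg translate1. Qed.

Lemma translateVK k : cancel (translate k^-1%g) (translate k).
Proof. by move=> a; rewrite -translateM mulgV translate1. Qed.

Lemma translate_le k a b :
  cayley_le a b -> cayley_le (translate k a) (translate k b).
Proof.
move=> [->|ab]; [by left|right].
case: a ab => [x||d|x c|]; case: b => [y||d'|y [c'|]|] //=; try by move=> ->.
(* The position of a target relative to a source does not change when both are translated. *)
suff -> : shift (k * y)^-1%g (shift k d) = shift y^-1%g d by [].
by apply: (can_inj (shiftK (k * y)%g)); rewrite shiftVK shiftM shiftVK.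
Qed.

Lemma translate_continuous k :
  continuous
    (translate k : alexandroff cayley_le -> alexandroff cayley_le).
Proof. by apply: monotone_continuous => a b; apply: translate_le. Qed.

(** * Automorphisms of the Cayley poset *)

Definition cayley_aut (f g : cayley K -> cayley K) : Prop :=
  [/\ cancel f g, cancel g f,
      forall a b, cayley_le a b -> cayley_le (f a) (f b) &
      forall a b, cayley_le a b -> cayley_le (g a) (g b)].

Lemma cayley_aut_sym f g : cayley_aut f g -> cayley_aut g f.
Proof. by case. Qed.

Lemma cayley_aut_max f g : cayley_aut f g ->
  forall b, cayley_max (f b) = cayley_max b.
Proof.
move=> [fK gK f_le g_le] b; apply/idP/idP => /cayley_maxP[a [ab le_ab]]; apply/cayley_maxP.
  exists (g a); split; last by rewrite -(fK b); apply: g_le.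
  by move=> /(congr1 f); rewrite gK.
exists (f a); split; last exact: f_le.
by move=> /(can_inj fK).
Qed.

(* [Apex] is the only minimal element below all maximal ones. *)
Lemma cayley_aut_apex f g : cayley_aut f g -> f Apex = Apex.
Proof.
move=> fg; have [fK gK f_le g_le] := fg.
have f_min : ~~ cayley_max (f Apex) by rewrite (cayley_aut_max fg).
have f_below e : cayley_max e -> cayley_lt (f Apex) e.
  move=> me; have : cayley_le (f Apex) e.
    rewrite -(gK e); apply: f_le; right.
    by move: me; rewrite -(cayley_aut_max (cayley_aut_sym fg)); case: (g e).
  by case=> // fe; rewrite fe me in f_min.
case: (f Apex) f_min f_below => [x||d|x c|] //= _ h.
  by have := h Lid erefl.
by have := h (Edge 1%g None) erefl.
Qed.

(** A purely order-theoretic description of the sources, which automorphisms therefore preserve. *)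
Definition is_src l : Prop :=
  [/\ ~~ cayley_max l, l <> Apex & exists e, [/\ cayley_max e, cayley_le l e &
    forall a, cayley_le a e -> [\/ a = e, a = Apex | a = l]]].

(** [Edge x None] is the witness for [Src x]. No target qualifies: a maximal element above it is
    either an edge, with a source below it, or [Lid], with two distinct targets below it. *)
Lemma is_srcP l : is_src l <-> exists x, l = Src x.
Proof.
split=> [[]|[x ->]]; last first.
  split=> //; exists (Edge x None); split=> //; first by right.
  move=> a [->|]; first by constructor 1.
  case: a => [y||d|y c|] //= => [->|_]; first by constructor 3.
  by constructor 2.
case: l => [x||d|x c|] //= _ _; first by exists x.
move=> [[x||d1|x c|] [] // _ _ h].
  by case: (h (Src x)) => //; right.
have := h (Tgt (true, 1%g)); have := h (Tgt (false, 1%g)).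
case=> //; first by right.
move=> <-; case=> //; first by right.
Qed.

Lemma cayley_aut_src f g : cayley_aut f g -> forall x, exists y, f (Src x) = Src y.
Proof.
move=> fg x; have [fK gK f_le g_le] := fg; apply/is_srcP.
have [|l_min l_apex [e [e_max le_e he]]] := (is_srcP (Src x)).2.
  by exists x.
split; first by rewrite (cayley_aut_max fg).
  by rewrite -(cayley_aut_apex fg) => /(can_inj fK).
exists (f e); split; [by rewrite (cayley_aut_max fg)|exact: f_le|].
move=> a ae; have [] := he (g a).
- by rewrite -(fK e); apply: g_le.
- by move=> <-; rewrite gK; constructor 1.
- move=> ga; constructor 2.
  by rewrite -(gK a) ga (cayley_aut_apex fg).
- by move=> <-; rewrite gK; constructor 3.
Qed.

(** At each source, [f] induces an automorphism of the well-order, which must be trivial. So [f]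
    acts on the targets as prescribed by the image of any one source, and comparing sources forces a
    translation. *)
Lemma cayley_aut_translate f g : cayley_aut f g -> exists k, f =1 translate k.
Proof.
move=> fg; have [fK gK f_le g_le] := fg.
have f_inj := can_inj fK.
have tgt_inj : injective (@Tgt K) by move=> d d' [].
have f_leE a b : cayley_le (f a) (f b) <-> cayley_le a b.
  by split=> [/g_le|/f_le//]; rewrite !fK.
have f_apex := cayley_aut_apex fg.
have f_max := cayley_aut_max fg.
have /choice[phi f_src] := cayley_aut_src fg.
have g_src := cayley_aut_src (cayley_aut_sym fg).
have f_tgt' d : exists d', f (Tgt d) = Tgt d'.
  case E : (f (Tgt d)) => [x||d'|x c|]; last 2 first.
  - by have := f_max (Tgt d); rewrite E.
  - by have := f_max (Tgt d); rewrite E.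
  - have [y gy] := g_src x.
    by have := fK (Tgt d); rewrite E gy.
  - by have := fK (Tgt d); rewrite E -f_apex fK.
  - by exists d'.
have /choice[psi f_tgt] := f_tgt'.
have g_tgt d : exists d', f (Tgt d') = Tgt d.
  have E := gK (Tgt d); case: (g (Tgt d)) E => [x||d'|x c|].
  - by rewrite f_src.
  - by rewrite f_apex.
  - by exists d'.
  - by move=> E; have := f_max (Edge x c); rewrite E.
  - by move=> E; have := f_max Lid; rewrite E.
(* [Lid] is the only maximal element with no source below it. *)
have f_lid : f Lid = Lid.
  case E : (f Lid) (f_max Lid) => [x||d|x c|] // _.
  have [y gy] := g_src x.
  have : cayley_le (g (Src x)) (g (f Lid)) by apply: g_le; rewrite E; right.
  by rewrite gy fK => -[].
have f_edge' x c : exists c', f (Edge x c) = Edge (phi x) c'.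
  have : cayley_le (f (Src x)) (f (Edge x c)) by apply: f_le; right.
  rewrite f_src.
  case E : (f (Edge x c)) (f_max (Edge x c)) => [y||d|y c'|] // _.
    by move=> [//|/= ->]; exists c'.
  by move: E; rewrite -f_lid => /f_inj.
have tgt_edgeN x d : ~ cayley_le (Tgt d) (Edge x None) by case.
have tgt_edge x d d' : cayley_le (Tgt d) (Edge x (Some d')) <-> wo (shift x^-1%g d) d'.
  by split=> [[]//|]; right.
(* Among the edges at one source, only the [None] edge has no target below it. *)
have f_edgeN x : f (Edge x None) = Edge (phi x) None.
  have [[d|] fx] := f_edge' x None; last by [].
  have [d' fd'] := g_tgt (shift (phi x) d).
  have : cayley_le (f (Tgt d')) (f (Edge x None)).
    by rewrite fx fd'; apply/tgt_edge; rewrite shiftK.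
  by move/f_leE/tgt_edgeN.
have f_edgeS' x d : exists d', f (Edge x (Some d)) = Edge (phi x) (Some d').
  have [[d'|] fx] := f_edge' x (Some d); first by exists d'.
  by have := f_inj _ _ (etrans fx (esym (f_edgeN x))).
have f_edgeS x d : f (Edge x (Some d)) = Edge (phi x) (Some d) /\
    psi (shift x d) = shift (phi x) d.
  have /choice[gam gamE] := f_edgeS' x.
  (* [alpha] is the action on targets read in coordinates relative to [x] and [phi x]; [gam] is the
     action on edge labels. They are shown to agree, so [alpha] preserves [wo]. *)
  pose alpha e := shift (phi x)^-1%g (psi (shift x e)).
  have wo_ag e e' : wo e e' = wo (alpha e) (gam e').
    apply/idP/idP => h.
      apply/tgt_edge; rewrite -f_tgt -gamE; apply: f_le; apply/tgt_edge.
      by rewrite shiftK.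
    rewrite -(shiftK x e); apply/tgt_edge/f_leE; rewrite f_tgt gamE.
    exact/tgt_edge.
  have alpha_inj : injective alpha.
    move=> e e' /(can_inj (shiftVK _)) h.
    by apply/(can_inj (shiftK x))/tgt_inj/f_inj; rewrite !f_tgt h.
  have alpha_surj e : exists e', alpha e' = e.
    have [e' fe'] := g_tgt (shift (phi x) e).
    exists (shift x^-1%g e'); rewrite /alpha shiftVK.
    by move: fe'; rewrite f_tgt => -[->]; rewrite shiftK.
  have gam_alpha e : gam e = alpha e.
    have [e' e'E] := alpha_surj (gam e).
    rewrite -e'E; congr alpha.
    (* With [gam e = alpha e'], the other comparison comes from
       [alpha e <= gam e = alpha e' <= gam e'], carried back by [wo_ag]. *)
    apply: wo_anti; first by rewrite wo_ag e'E.
    rewrite wo_ag; apply: wo_trans (_ : wo (alpha e') (gam e')).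
      by rewrite e'E -wo_ag.
    by rewrite -wo_ag.
  have alpha_id e0 : alpha e0 = e0.
    apply: (well_order_auto_id wo_well_order alpha_inj alpha_surj) => e e'.
    by rewrite wo_ag gam_alpha.
  split; first by rewrite gamE gam_alpha alpha_id.
  by rewrite -{2}(alpha_id d) /alpha shiftVK.
(* The target [(true, x)] is seen both from the source [x] and from the source [1]; the two formulas
   for its image agree. *)
have phiM x : phi x = (phi 1 * x)%g.
  have [_] := f_edgeS x (true, 1%g); have [_] := f_edgeS 1%g (true, x).
  by rewrite /shift /= !mulg1 mul1g => -> [].
exists (phi 1%g) => -[x||d|x [c|]|] //=.
- by rewrite f_src phiM.
- by have [_] := f_edgeS 1%g d; rewrite shift1 f_tgt => ->.
- by have [-> _] := f_edgeS x c; rewrite phiM.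
- by rewrite f_edgeN phiM.
Qed.

(** * Homotopy rigidity of the Cayley poset *)

(** In height one an element between two others equals one of them, so the meet conditions reduce to
    [b1 <> b2] and the join conditions to [a1 <> a2]. *)
Lemma cayley_crown a1 a2 b1 b2 :
  a1 <> a2 -> b1 <> b2 ->
  cayley_lt a1 b1 -> cayley_lt a1 b2 -> cayley_lt a2 b1 -> cayley_lt a2 b2 ->
  crown cayley_le a1 a2 b1 b2.
Proof.
move=> a12 b12 l11 l12 l21 l22.
have [m1 n1] := cayley_lt_max l11; have [m2 n2] := cayley_lt_max l22.
have meet a y : cayley_le a y -> cayley_le y b1 -> cayley_le y b2 -> y = a.
  move=> [//|/cayley_lt_max[_ my]] /(cayley_le_max my) y1.
  by move=> /(cayley_le_max my); rewrite -y1 => /esym/b12.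
have join b y : cayley_le a1 y -> cayley_le a2 y -> cayley_le y b -> y = b.
  move=> h1 h2 [//|/cayley_lt_max[my _]].
  by case: a12; rewrite (cayley_le_min my h1) (cayley_le_min my h2).
split; try (by right); try exact: meet; try exact: join.
- by move=> y; apply: cayley_le_min.
- by move=> y; apply: cayley_le_min.
- by move=> y; apply: cayley_le_max.
- by move=> y; apply: cayley_le_max.
Qed.

(** Two families of crowns cover the poset: [Src x] and [Apex] under two edges at [x], and [Tgt d]
    and [Apex] under [Lid] and [Edge 1 (Some d)]. *)
Lemma cayley_homotopy_rigid (R : realType)
    (f : alexandroff cayley_le -> alexandroff cayley_le) :
  homotopic R idfun f -> f =1 id.
Proof.
move=> [h [ch h0 h1]] a.
have t01 : `[0%R, 1%R] (1%R : R) by rewrite /= in_itv /= lexx ler01.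
have fixed a1 a2 b1 b2 : crown cayley_le a1 a2 b1 b2 ->
    [/\ f a1 = a1, f a2 = a2, f b1 = b1 & f b2 = b2].
  move=> cr; rewrite -!h1.
  exact: (crown_homotopy_fixed cayley_le_refl cayley_le_trans cr ch h0 t01).
have fixed_edge x c c' : c <> c' -> f (Edge x c) = Edge x c /\ f (Src x) = Src x.
  move=> cc'; have [] // := fixed (Src x) Apex (Edge x c) (Edge x c').
  by apply: cayley_crown => //; case.
have fixed_tgt d : [/\ f (Tgt d) = Tgt d, f Apex = Apex & f Lid = Lid].
  have [] // := fixed (Tgt d) Apex Lid (Edge 1%g (Some d)).
  by apply: cayley_crown => //=; rewrite invg1 shift1.
case: a => [x||d|x [c|]|].
- by have [] := fixed_edge x None (Some (true, 1%g)).
- by have [] := fixed_tgt (true, 1%g).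
- by have [] := fixed_tgt d.
- by have [] := fixed_edge x (Some c) None.
- by have [] := fixed_edge x None (Some (true, 1%g)).
- by have [] := fixed_tgt (true, 1%g).
Qed.

End Cayley.

(** * The glued poset and its homeomorphisms *)

Section Glue.
Variables (G H : groupType).

Definition glued : Type := (cayley H + cayley G)%type.

HB.instance Definition _ := Choice.on glued.

(** Maximality of this point makes [glued_le] transitive, and only the trivial translation fixes
    it. *)
Definition glue_pt : cayley H := Edge 1%g None.

(* The whole copy of [cayley G] is put below [glue_pt] and is thereby
   contractible onto it. *)
Definition glued_le (a b : glued) : Prop :=
  match a, b with
  | inl a, inl b => cayley_le a b
  | inr a, inr b => cayley_le a b
  | inr _, inl b => b = glue_pt
  | inl _, inr _ => False
  end.

Lemma glued_le_refl a : glued_le a a.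
Proof. by case: a => a; apply: cayley_le_refl. Qed.

Lemma glued_le_trans a b c : glued_le a b -> glued_le b c -> glued_le a c.
Proof.
case: a b c => [a|a] [b|b] [c|c] //=; try exact: cayley_le_trans.
by move=> -> /(cayley_le_max (a := glue_pt) isT).
Qed.

Let X : topologicalType := alexandroff glued_le.
Let Y : topologicalType := alexandroff (@cayley_le H).

Definition glued_map (f : cayley H -> cayley H) (g : cayley G -> cayley G)
    (a : glued) : glued :=
  match a with inl a => inl (f a) | inr a => inr (g a) end.

Definition glued_translate (k : G) : glued -> glued :=
  glued_map id (translate k).

Lemma glued_translateK k :
  cancel (glued_translate k) (glued_translate k^-1%g).
Proof. by case=> a //=; rewrite translateK. Qed.

Lemma glued_translateVK k :
  cancel (glued_translate k^-1%g) (glued_translate k).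
Proof. by case=> a //=; rewrite translateVK. Qed.

Lemma glued_translate_continuous k : continuous (glued_translate k : X -> X).
Proof.
apply: monotone_continuous => -[a|a] [b|b] //=; exact: translate_le.
Qed.

Lemma glued_translate_homeo k : homeomorphism (glued_translate k : X -> X).
Proof.
split; first exact: glued_translate_continuous.
exists (glued_translate k^-1%g); split.
- exact: glued_translate_continuous.
- exact: glued_translateK.
- exact: glued_translateVK.
Qed.

Definition glued_mid (b : glued) : Prop :=
  exists a c, [/\ a <> b, b <> c, glued_le a b & glued_le b c].

(** Both pieces have height one, so a three-element chain must climb inside [cayley G] and then step
    to [glue_pt]. This lets the order alone recognise the [cayley G] part. *)
Lemma glued_midP b : glued_mid b <-> exists2 e, cayley_max e & b = inr e.
Proof.
split=> [[a [c [ab bc le_ab le_bc]]]|[e /cayley_maxP[a [ae le_ae]] ->]].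
  case: b a c ab bc le_ab le_bc => [b|b] [a|a] [c|c] //= ab bc le_ab le_bc.
  - have /cayley_le_max/(_ le_bc) cb : cayley_max b.
      by apply/cayley_maxP; exists a; split=> // aE; apply: ab; rewrite aE.
    by case: bc; rewrite cb.
  - have /cayley_le_max/(_ le_bc) cb : cayley_max b by rewrite le_ab.
    by case: bc; rewrite cb.
  - by exists b => //; apply/cayley_maxP; exists a; split=> // aE; apply: ab; rewrite aE.
  - by exists b => //; apply/cayley_maxP; exists a; split=> // aE; apply: ab; rewrite aE.
exists (inr a), (inl glue_pt); split=> //.
by move=> [].
Qed.

Lemma glued_inrP a : (exists b, a = inr b) <->
  exists e, glued_mid e /\ glued_le a e.
Proof.
split=> [[b ->]|[_ [/glued_midP[e _ ->]]]]; last by case: a => // b; exists b.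
have [e [e_max be]] := ex_cayley_max b.
by exists (inr e); split=> //; apply/glued_midP; exists e.
Qed.

Section GluedAut.
Variables (f g : glued -> glued).
Hypotheses (fK : cancel f g) (gK : cancel g f).
Hypothesis f_le : forall a b, glued_le a b -> glued_le (f a) (f b).
Hypothesis g_le : forall a b, glued_le a b -> glued_le (g a) (g b).

Let f_mid b : glued_mid b -> glued_mid (f b).
Proof.
move=> [a [c [ab bc le_ab le_bc]]]; exists (f a), (f c); split.
- by move=> /(can_inj fK).
- by move=> /(can_inj fK).
- exact: f_le.
- exact: f_le.
Qed.

Lemma glued_aut_inr b : exists b', f (inr b) = inr b'.
Proof.
apply/glued_inrP; have /glued_inrP[e [me be]] : exists b', inr b = inr b' :> glued.
  by exists b.
by exists (f e); split; [exact: f_mid|exact: f_le].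
Qed.

End GluedAut.

Lemma glued_aut_translate (f g : glued -> glued) :
  cancel f g -> cancel g f ->
  (forall a b, glued_le a b -> glued_le (f a) (f b)) ->
  (forall a b, glued_le a b -> glued_le (g a) (g b)) ->
  exists k, f =1 glued_translate k.
Proof.
move=> fK gK f_le g_le.
have /choice[fG fGE] := glued_aut_inr fK f_le.
have /choice[gG gGE] := glued_aut_inr gK g_le.
(* A point of the left part sent to the right part could not be brought back, since the inverse
   preserves the right part. *)
have inl_of (u v : glued -> glued) w : cancel u v ->
    (forall b, v (inr b) = inr (w b)) -> forall a, exists a', u (inl a) = inl a'.
  move=> uK vE a; case E : (u (inl a)) => [a'|b]; first by exists a'.
  by have := uK (inl a); rewrite E vE.
have /choice[fH fHE] := inl_of _ _ _ fK gGE.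
have /choice[gH gHE] := inl_of _ _ _ gK fGE.
have [k kE] : exists k, fG =1 translate k.
  apply: (cayley_aut_translate (g := gG)); split=> [b|b|a b|a b].
  - by have := fK (inr b); rewrite fGE gGE => -[].
  - by have := gK (inr b); rewrite gGE fGE => -[].
  - by move=> ab; have := f_le (inr a) (inr b) ab; rewrite !fGE.
  - by move=> ab; have := g_le (inr a) (inr b) ab; rewrite !gGE.
have [l lE] : exists l, fH =1 translate l.
  apply: (cayley_aut_translate (g := gH)); split=> [b|b|a b|a b].
  - by have := fK (inl b); rewrite fHE gHE => -[].
  - by have := gK (inl b); rewrite gHE fHE => -[].
  - by move=> ab; have := f_le (inl a) (inl b) ab; rewrite !fHE.
  - by move=> ab; have := g_le (inl a) (inl b) ab; rewrite !gHE.
(* Something of the [cayley G] part lies below the image of [glue_pt], so that image is [glue_pt]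
   itself. *)
have l1 : l = 1%g.
  have := f_le (inr Apex) (inl glue_pt) erefl.
  by rewrite fGE fHE lE /= => -[]; rewrite mulg1.
exists k => -[a|b]; first by rewrite fHE lE l1 translate1.
by rewrite fGE kE.
Qed.

Lemma AutTop_glued : group_isomorphic (AutTop X) G.
Proof.
apply: (@group_isomorphic_inv _ _ (fun k => mkAutTop (glued_translate_homeo k))).
- move=> k k'; apply: aut_eqP => -[a|b]; first by [].
  exact: (congr1 inr (translateM k k' b)).
- move=> k k' kk'.
  have : inr (Src (k * 1)%g) = inr (Src (k' * 1)%g) :> glued.
    exact: (congr1 (fun u : AutTop X => val u (inr (Src 1%g))) kk').
  by rewrite !mulg1 => -[].
- move=> u; have [cu [v [cv uK vK]]] := autP u.
  have mono (w : X -> X) : continuous w ->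
      forall a b, glued_le a b -> glued_le (w a) (w b).
    move=> cw a b.
    exact: (continuous_monotone glued_le_refl glued_le_trans cw).
  have [k kE] := glued_aut_translate uK vK (mono _ cu) (mono _ cv).
  by exists k; apply: aut_eqP => a; rewrite kE.
Qed.

(** * The homotopy type of the glued poset *)

Definition retract (a : glued) : cayley H :=
  match a with inl a => a | inr _ => glue_pt end.

Let p : X -> Y := retract.
Let s : Y -> X := inl.

Let p_continuous : continuous p.
Proof.
apply: monotone_continuous => -[a|a] [b|b] //=; last by left.
by move=> ->; left.
Qed.

Let s_continuous : continuous s.
Proof. exact: monotone_continuous. Qed.

Let sp_continuous : continuous (s \o p).
Proof.
by move=> a; apply: continuous_comp; [exact: p_continuous|exact: s_continuous].
Qed.

Variable R : realType.

(** The homotopy is the identity before time 1 and jumps to [s \o p] at time 1. The jump is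
    continuous because [s \o p] only moves points up: the preimage of a down-set [U] under [s \o p]
    lies inside [U]. *)
Lemma glued_deformation : homotopic R (@idfun X) (s \o p).
Proof.
exists (fun q : X * R => if (q.2 < 1)%R then q.1 else s (p q.1)); split; last first.
- by move=> x /=; rewrite ltxx.
- by move=> x /=; rewrite ltr01.
apply: continuous_subspaceT; apply/continuousP => U oU.
have spU : (s \o p) @^-1` U `<=` U.
  by case=> [a|a] //= Ua; apply: (oU (inl glue_pt)).
set V := _ @^-1` U.
have -> : V = (fst @^-1` U `&` snd @^-1` [set t : R | (t < 1)%R]) `|`
    fst @^-1` ((s \o p) @^-1` U).
  rewrite eqEsubset; split => -[a t]; rewrite /V /=.
    by case: ifP => h Ua; [left|right].
  by case: ifP => h [[]//|] //; move/spU.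
have fst_open : forall W, open W -> open ((fst : X * R -> X) @^-1` W).
  by apply/continuousP => q; exact: cvg_fst.
have snd_open : forall W, open W -> open ((snd : X * R -> R) @^-1` W).
  by apply/continuousP => q; exact: cvg_snd.
apply: openU; first by apply: openI; [exact: fst_open|apply: snd_open; exact: open_lt].
by apply: fst_open; move/continuousP : sp_continuous; apply.
Qed.

(** A nontrivial translation of [cayley H] moves [glue_pt] and extends to no homeomorphism of [X];
    passing through the retraction gives a homotopy equivalence instead. *)
Let lift_translate (k : H) : X -> X := s \o translate k \o p.

Let lift_translate_continuous k : continuous (lift_translate k).
Proof.
move=> a; apply: continuous_comp; first exact: p_continuous.
by apply: continuous_comp; [exact: translate_continuous|exact: s_continuous].
Qed.

Let lift_translateK k :
  homotopic R (lift_translate k^-1%g \o lift_translate k) (@idfun X).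
Proof.
have -> : lift_translate k^-1%g \o lift_translate k = s \o p.
  by apply/funext => a /=; rewrite /lift_translate /= translateK.
exact/homotopic_sym/glued_deformation.
Qed.

Let lift_translate_equiv k : homotopy_equivalence R (lift_translate k).
Proof.
split; first exact: lift_translate_continuous.
exists (lift_translate k^-1%g); split; [exact: lift_translate_continuous|
  exact: lift_translateK|].
by rewrite -{1}(invgK k); exact: lift_translateK.
Qed.

Let pos_continuous (f : X -> X) : continuous f -> continuous (p \o f \o s).
Proof.
move=> cf a; apply: continuous_comp; first exact: s_continuous.
by apply: continuous_comp; [exact: cf|exact: p_continuous].
Qed.

Let pos_homotopic (f f' : X -> X) : continuous f -> continuous f' ->
  homotopic R f f' -> homotopic R (p \o f \o s) (p \o f' \o s).
Proof.
move=> cf cf' ff'.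
apply: (homotopic_comp (f := s) (f' := s) (g := p \o f) (g' := p \o f')).
- exact: s_continuous.
- by move=> a; apply: continuous_comp; [exact: cf|exact: p_continuous].
- exact/homotopic_refl/s_continuous.
- apply: (homotopic_comp (f := f) (f' := f') (g := p) (g' := p)) => //.
  exact/homotopic_refl/p_continuous.
Qed.

Let homotopic_sp (f g : X -> X) : continuous f -> continuous g ->
  homotopic R (f \o g) (f \o (s \o p) \o g).
Proof.
move=> cf cg.
apply: (homotopic_comp (f := g) (f' := g) (g := f) (g' := f \o (s \o p))) => //.
  exact: homotopic_refl.
apply: (homotopic_comp (f := @idfun X) (f' := s \o p) (g := f) (g' := f)) => //.
  exact: glued_deformation.
exact: homotopic_refl.
Qed.

(** Since [s \o p] is homotopic to the identity, the composite on [cayley H] is homotopic to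
    [p \o (g \o f) \o s], hence to the identity. Rigidity turns this homotopy into an equality. *)
Let pos_inverse (f g : X -> X) : continuous f -> continuous g ->
  homotopic R (g \o f) idfun -> cancel (p \o f \o s) (p \o g \o s).
Proof.
move=> cf cg gf.
have cgf : continuous (g \o f).
  by move=> a; apply: continuous_comp; [exact: cf|exact: cg].
apply: (@cayley_homotopy_rigid H R).
apply: (homotopic_trans (g := p \o (g \o f) \o s)).
  apply/homotopic_sym/(pos_homotopic (f' := idfun)) => //.
  by move=> a.
apply: (pos_homotopic (f := g \o f) (f' := g \o (s \o p) \o f)) => //.
  move=> a; apply: continuous_comp; first exact: cf.
  apply: continuous_comp; last exact: cg.
  exact: sp_continuous.
exact: homotopic_sp.
Qed.

Lemma hAut_glued : group_isomorphic (hAut R X) H.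
Proof.
pose psi k : hAut R X := \pi_(hAut R X)%qT (mk_self_equiv (lift_translate_equiv k)).
apply: (@group_isomorphic_inv _ _ psi).
- move=> k k'; apply: etrans (esym (hAut_mulE _ _)).
  congr (\pi_(hAut R X)%qT _); apply/val_inj/continuousEP => a.
  exact: (congr1 inl (translateM k k' (p a))).
(* Homotopic lifts restrict to homotopic translations; by rigidity [translate k^-1 \o translate k']
   is the identity, and its value at [Src 1] gives [k = k']. *)
- move=> k k' /hAut_eqP /= kk'.
  have : homotopic R (@idfun Y) (translate k^-1%g \o translate k').
    have -> : @idfun Y = translate k^-1%g \o translate k.
      by apply/funext => a /=; rewrite translateK.
    apply: (homotopic_comp (X := Y) (Y := Y) (Z := Y) (f := translate k)
      (f' := translate k')); try exact: translate_continuous.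
      apply: (pos_homotopic (f := lift_translate k) (f' := lift_translate k'));
        [exact: lift_translate_continuous..|exact: kk'].
    exact/homotopic_refl/translate_continuous.
  move=> /cayley_homotopy_rigid /(_ (Src 1%g)) /=.
  rewrite !mulg1 => -[] /(congr1 (fun x => k * x)%g).
  by rewrite mulgA mulgV mul1g mulg1.
- elim/quotW => u; have [cu [v [cv vu uv]]] := self_equivP u.
  have mono (w : X -> X) : continuous w -> forall a b, cayley_le a b ->
      cayley_le ((p \o w \o s) a) ((p \o w \o s) b).
    move=> cw a b.
    apply: (continuous_monotone (@cayley_le_refl H) (@cayley_le_trans H)).
    exact: pos_continuous.
  have [k kE] : exists k, p \o val u \o s =1 translate k.
    apply: (cayley_aut_translate (g := p \o v \o s)); split.
    + exact: pos_inverse.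
    + exact: pos_inverse.
    + exact: mono.
    + exact: mono.
  exists k; apply/hAut_eqP/homotopic_sym.
  suff : homotopic R (val u) (lift_translate k) by [].
  (* Composing [u] with [s \o p] on both sides keeps its homotopy class. *)
  have -> : lift_translate k = (s \o p) \o val u \o (s \o p).
    by apply/funext => a; rewrite /lift_translate /= -kE.
  apply: (homotopic_comp (f := @idfun X) (f' := s \o p) (g := val u)
    (g' := (s \o p) \o val u)) => //; first exact: glued_deformation.
  apply: (homotopic_comp (f := val u) (f' := val u) (g := @idfun X)
    (g' := s \o p)) => //; last exact: glued_deformation.
    by move=> a.
  exact: homotopic_refl.
Qed.

End Glue.

Theorem lemma1p1 (R : realType) (G H : groupType) :
  exists X : topologicalType,
    group_isomorphic (AutTop X) G /\ group_isomorphic (hAut R X) H.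
Proof.
by exists (alexandroff (@glued_le G H)); split; [exact: AutTop_glued|exact: hAut_glued].
Qed.
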